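(* Let $\mathbb{K}$ be a commutative ring with identity and let $N$ be a Nijenhuis operator on a Lie $\mathbb{K}$-affgebra $(A,[-,-])$. For $k\in\mathbb{N}$ let $N^k$ denote the $k$-th composition power of $N$, with $N^0=\mathrm{id}$. Then, for all $k,l\in\mathbb{N}$: (1) $N^k$ is a Nijenhuis operator on $(A,[-,-])$. (2) $N^l$ is a Nijenhuis operator on $(A,[-,-]_{N^k})$, where $[a,b]_{N^k}=\langle [N^k a,b],N^k[a,b],[a,N^k b]\rangle$. (3) For all $\alpha\in\mathbb{K}$, the map $$N_\alpha^{k,l}:=\alpha\triangleright_{N^k}N^l:A\longrightarrow A,\qquad a\longmapsto \alpha\triangleright_{N^k a}N^l a,$$ is a Nijenhuis operator on $(A,[-,-])$.
   Context: Here $\mathbb{N}$ includes $0$. An abelian heap is a set $A$ with a ternary operation $\langle -,-,-\rangle:A^3\to A$ such that for all $a,b,c,d,e\in A$: $\langle\langle a,b,c\rangle,d,e\rangle=\langle a,b,\langle c,d,e\rangle\rangle$, $\langle a,b,b\rangle=a=\langle b,b,a\rangle$, $\langle a,b,c\rangle=\langle c,b,a\rangle$. Heap homomorphisms are maps preserving the ternary operation. One writes $\langle a_1,\ldots,a_{2n+1}\rangle:=\langle\ldots\langle\langle a_1,a_2,a_3\rangle,a_4,a_5\rangle,\ldots,a_{2n+1}\rangle$. An affine $\mathbb{K}$-module ($\mathbb{K}$ a commutative ring with identity) is a non-empty abelian heap $A$ with a map $\mathbb{K}\times A\times A\to A$, $(\alpha,a,b)\mapsto\alpha\triangleright_a b$,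 such that for all $a,b,c\in A$, $\alpha,\beta\in\mathbb{K}$: (a) $\alpha\triangleright_a-:A\to A$ and $-\triangleright_a b:\mathbb{K}\to A$ are heap homomorphisms, where $\mathbb{K}$ is a heap via $\alpha-\beta+\gamma$; (b) $(\alpha\beta)\triangleright_a b=\alpha\triangleright_a(\beta\triangleright_a b)$; (c) $\alpha\triangleright_a b=\langle\alpha\triangleright_c b,\alpha\triangleright_c a,a\rangle$; (d) $0\triangleright_a b=a$ and $1\triangleright_a b=b$. A homomorphism of affine $\mathbb{K}$-modules (affine map) is a heap homomorphism $f$ with $f(\alpha\triangleright_a b)=\alpha\triangleright_{f(a)}f(b)$. A map $A\times A\to A$ is bi-affine if it is an affine map in each argument separately. A Lie bracket on an affine $\mathbb{K}$-module $A$ (by convention, a left Lie bracket) is a bi-affine map $[-,-]:A\times A\to A$ such that for all $a,b,c\in A$: $\langle [a,b],[a,a],[b,a]\rangle=[b,b]$ and $\langle [a,[b,c]],[a,a],[b,[c,a]],[b,b],[c,[a,b]]\rangle=[c,c]$. An affine $\mathbb{K}$-module with a Lie bracket is called a Lie $\mathbb{K}$-affgebra. A Nijenhuis operator on a Lie affgebra $(A,[-,-])$ is an affine map $N:A\to A$ such that for all $a,b\in A$: $[Na,Nb]=N\big(\langle [Na,b],N[a,b],[a,Nb]\rangle\big)$. The operation $[a,b]_N=\langle [Na,b],N[a,b],[a,Nb]\rangle$ is the associated Nijenhuis bracket; it is a Lie bracket on $A$ whenever $N$ is a Nijenhuis operator. *)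

(* Defs.v *)
From mathcomp Require Import ssreflect ssrfun ssrbool ssrnat ssralg.
Set Implicit Arguments.
Unset Strict Implicit.
Unset Printing Implicit Defensive.
Import GRing.Theory.
Local Open Scope ring_scope.

Record abelianHeap := AbelianHeap {
  heap_sort :> Type;
  heap_op : heap_sort -> heap_sort -> heap_sort -> heap_sort;
  heap_opA : forall a b c d e,
    heap_op (heap_op a b c) d e = heap_op a b (heap_op c d e);
  heap_opKr : forall a b, heap_op a b b = a;
  heap_opKl : forall a b, heap_op b b a = a;
  heap_opC : forall a b c, heap_op a b c = heap_op c b a
}.

Notation "[< a , b , c >]" := (heap_op a b c)
  (at level 0, a, b, c at level 200, format "[< a ,  b ,  c >]").
Notation "[< a , b , c , d , e >]" := (heap_op (heap_op a b c) d e)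
  (at level 0, a, b, c, d, e at level 200,
   format "[< a ,  b ,  c ,  d ,  e >]").

Definition heap_hom (A B : abelianHeap) (f : A -> B) : Prop :=
  forall a b c : A, f [< a, b, c >] = [< f a, f b, f c >].

Section ZmodHeap.
Variable V : zmodType.

Definition zmod_op (x y z : V) : V := x - y + z.

Fact zmod_opA a b c d e :
  zmod_op (zmod_op a b c) d e = zmod_op a b (zmod_op c d e).
Proof. by rewrite /zmod_op !addrA. Qed.

Fact zmod_opKr a b : zmod_op a b b = a.
Proof. exact: subrK. Qed.

Fact zmod_opKl a b : zmod_op b b a = a.
Proof. by rewrite /zmod_op subrr add0r. Qed.

Fact zmod_opC a b c : zmod_op a b c = zmod_op c b a.
Proof. by rewrite /zmod_op addrC addrA addrAC. Qed.

Definition zmod_heap : abelianHeap :=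
  AbelianHeap zmod_opA zmod_opKr zmod_opKl zmod_opC.

End ZmodHeap.

(* [aff_act alpha a b] is alpha |>_a b: the second argument is the base point.
   The scalars form a [comPzRingType], so that the zero ring is allowed. *)
Record affineModule (K : comPzRingType) := AffineModule {
  aff_heap :> abelianHeap;
  aff_act : K -> aff_heap -> aff_heap -> aff_heap;
  aff_inhabited : inhabited aff_heap;
  aff_act_homr : forall (alpha : K) (a : aff_heap),
    heap_hom (aff_act alpha a);
  aff_act_homl : forall a b : aff_heap,
    @heap_hom (zmod_heap K) aff_heap (fun alpha : K => aff_act alpha a b);
  aff_actM : forall (alpha beta : K) (a b : aff_heap),
    aff_act (alpha * beta) a b = aff_act alpha a (aff_act beta a b);
  aff_act_base : forall (alpha : K) (a b c : aff_heap),
    aff_act alpha a b = [< aff_act alpha c b, aff_act alpha c a, a >];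
  aff_act0 : forall a b : aff_heap, aff_act 0 a b = a;
  aff_act1 : forall a b : aff_heap, aff_act 1 a b = b
}.

Section LieAffgebra.
Variable K : comPzRingType.

Definition affine_map (A B : affineModule K) (f : A -> B) : Prop :=
  heap_hom f /\
  forall (alpha : K) (a b : A),
    f (aff_act alpha a b) = aff_act alpha (f a) (f b).

Variable A : affineModule K.

Definition bi_affine (br : A -> A -> A) : Prop :=
  (forall a, affine_map (br a)) /\ (forall b, affine_map (fun a => br a b)).

Record lie_bracket (br : A -> A -> A) : Prop := LieBracket {
  lie_bi_affine : bi_affine br;
  lie_antisym : forall a b, [< br a b, br a a, br b a >] = br b b;
  lie_jacobi : forall a b c,
    [< br a (br b c), br a a, br b (br c a), br b b, br c (br a b) >] = br c c
}.

Definition nijenhuis_bracket (br : A -> A -> A) (N : A -> A) : A -> A -> A :=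
  fun a b => [< br (N a) b, N (br a b), br a (N b) >].

Record nijenhuis_operator (br : A -> A -> A) (N : A -> A) : Prop :=
  NijenhuisOperator {
    nijenhuis_affine : affine_map N;
    nijenhuis_eq : forall a b,
      br (N a) (N b) = N [< br (N a) b, N (br a b), br a (N b) >]
  }.

End LieAffgebra.

(* Main.v *)
(** Call two affine maps [P], [Q] compatible if
    [[Pa,Qb] = P[a,Qb] - PQ[a,b] + Q[Pa,b]] for all [a], [b]; thus [N] is a
    Nijenhuis operator iff it is compatible with itself.  Compatibility is
    multiplicative in each argument along commuting maps, so all the powers of
    [N] are mutually compatible, and it is affine in each argument, so it passes
    to the affine combinations of [N^k] and [N^l].  The Jacobi sum of [[-,-]_N]
    at [(a,b,c)] is
    [J(Na,Nb,c) + J(Na,b,Nc) + J(a,Nb,Nc)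
     - N (J(Na,b,c) + J(a,Nb,c) + J(a,b,Nc)) + N^2 J(a,b,c)],
    where [J] is the Jacobi sum of [[-,-]]. *)
Require Import Defs.
From mathcomp Require Import ssreflect ssrfun ssrbool ssrnat ssralg.
From Stdlib Require Import Ring.
Import GRing.Theory.
Local Open Scope ring_scope.

Section Affine.
Context {K : comPzRingType} {A : affineModule K}.

Section SquareZeroExtension.
(* Once a base point [o] is chosen, [A] is a [K]-module, and affine identities
   become identities in the commutative ring [K (+) A] with [A * A = 0], where
   the [ring] tactic decides them. *)
Variable o : A.

Let madd (a b : A) : A := [< a, o, b >].
Let mopp (a : A) : A := [< o, a, o >].
Let mscale (x : K) (a : A) : A := aff_act x o a.

Let maddC a b : madd a b = madd b a.
Proof. exact: heap_opC. Qed.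

Let maddA a b c : madd a (madd b c) = madd (madd a b) c.
Proof. by rewrite /madd heap_opA. Qed.

Let madd0 a : madd o a = a.
Proof. exact: heap_opKl. Qed.

Let maddN a : madd a (mopp a) = o.
Proof. by rewrite /madd /mopp -heap_opA heap_opKr heap_opKl. Qed.

Let maddACA a b c d :
  madd (madd a b) (madd c d) = madd (madd a c) (madd b d).
Proof. by rewrite -!maddA (maddA b) (maddC b) -maddA. Qed.

Let mscale0 x : mscale x o = o.
Proof. by rewrite /mscale (aff_act_base x o o o) heap_opKl. Qed.

Let mscaleDr x a b : mscale x (madd a b) = madd (mscale x a) (mscale x b).
Proof. by rewrite /mscale /madd aff_act_homr -/(mscale x o) mscale0. Qed.

Let mscaleDl x y a : mscale (x + y) a = madd (mscale x a) (mscale y a).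
Proof.
have -> : x + y = @heap_op (zmod_heap K) x 0 y by rewrite /= /zmod_op subr0.
by rewrite /mscale aff_act_homl aff_act0.
Qed.

Let mscaleM x y a : mscale (x * y) a = mscale x (mscale y a).
Proof. exact: aff_actM. Qed.

Let mscale1 a : mscale 1 a = a.
Proof. exact: aff_act1. Qed.

Let ext : Type := (K * A)%type.
Let ext0 : ext := (0, o).
Let ext1 : ext := (1, o).
Let extD (u v : ext) : ext := (u.1 + v.1, madd u.2 v.2).
Let extM (u v : ext) : ext :=
  (u.1 * v.1, madd (mscale u.1 v.2) (mscale v.1 u.2)).
Let extN (u : ext) : ext := (- u.1, mopp u.2).
Let extB (u v : ext) : ext := extD u (extN v).

Let ext_ring_theory : ring_theory ext0 ext1 extD extM extB extN eq.
Proof.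
have scale0l a : mscale 0 a = o by exact: aff_act0.
split=> [[x a]|[x a] [y b]|[x a] [y b] [z c]|[x a]|[x a] [y b]
  |[x a] [y b] [z c]|[x a] [y b] [z c]|//|[x a]]; rewrite /extD /extM /extN /=.
- by rewrite add0r madd0.
- by rewrite addrC maddC.
- by rewrite addrA maddA.
- by rewrite mul1r mscale1 mscale0 (maddC a) madd0.
- by rewrite mulrC maddC.
- rewrite mulrA !mscaleDr -!mscaleM maddA; congr pair.
  by rewrite (mulrC z x) (mulrC z y).
- by rewrite mulrDl mscaleDl mscaleDr maddACA.
- by rewrite subrr maddN.
Qed.

Add Ring ext_ring : ext_ring_theory.

Let emb (a : A) : ext := (0, a).
Let scal (x : K) : ext := (x, o).

Let emb_inj a b : emb a = emb b -> a = b.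
Proof. by case. Qed.

Let emb_op a b c : emb [< a, b, c >] = extD (extB (emb a) (emb b)) (emb c).
Proof.
rewrite /extB /extD /extN /emb /= oppr0 !addr0; congr pair.
by rewrite /madd /mopp !heap_opA heap_opKl -heap_opA heap_opKr.
Qed.

Let emb_act x a b :
  emb (aff_act x a b) =
  extD (emb a) (extM (scal x) (extB (emb b) (emb a))).
Proof.
have embZ c : emb (aff_act x o c) = extM (scal x) (emb c).
  by rewrite /extM /emb /scal /= mulr0 mscale0 maddC madd0.
(* Base change moves the action from [a] to [o], where it is multiplication by [scal x]. *)
by rewrite (aff_act_base x a b o) emb_op !embZ; ring.
Qed.

Let embE := (emb_op, emb_act).

Local Ltac affine := apply: emb_inj; rewrite !embE; ring.

(** * Closure properties of affine maps *)

Lemma affine_map_op {P Q R : A -> A} :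
  affine_map P -> affine_map Q -> affine_map R ->
  affine_map (fun a => [< P a, Q a, R a >]).
Proof.
move=> [Pop Pact] [Qop Qact] [Rop Ract].
by split=> [a b c|x a b]; rewrite ?(Pop, Qop, Rop) ?(Pact, Qact, Ract); affine.
Qed.

(** The actions of [x] and [y] interchange because [K] is commutative. *)
Lemma affine_map_act (x : K) {P Q : A -> A} :
  affine_map P -> affine_map Q -> affine_map (fun a => aff_act x (P a) (Q a)).
Proof.
move=> [Pop Pact] [Qop Qact].
by split=> [a b c|y a b]; rewrite ?(Pop, Qop) ?(Pact, Qact); affine.
Qed.

Lemma affine_map_id : affine_map (@id A).
Proof. by []. Qed.

Lemma affine_map_comp {P Q : A -> A} :
  affine_map P -> affine_map Q -> affine_map (fun a => P (Q a)).
Proof.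
move=> [Pop Pact] [Qop Qact].
by split=> [a b c|x a b]; rewrite ?(Qop, Qact) ?(Pop, Pact).
Qed.

Lemma affine_map_iter {P : A -> A} k : affine_map P -> affine_map (iter k P).
Proof.
by move=> Paff; elim: k => [|k IHk]; [exact: affine_map_id|exact: affine_map_comp].
Qed.

(** * Calculus of compatible pairs for a bi-affine bracket *)

Section Compatible.
Variable br : A -> A -> A.
Hypothesis br_aff : bi_affine br.

Let brr_aff a : affine_map (br a). Proof. exact: br_aff.1. Qed.
Let brl_aff b : affine_map (fun a => br a b). Proof. exact: br_aff.2. Qed.
Let brr_act a x b c : br a (aff_act x b c) = aff_act x (br a b) (br a c).
Proof. exact: (brr_aff a).2. Qed.
Let brl_act x a b c : br (aff_act x a b) c = aff_act x (br a c) (br b c).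
Proof. exact: (brl_aff c).2. Qed.

Definition compatible (P Q : A -> A) : Prop :=
  forall a b,
    br (P a) (Q b) = [< P (br a (Q b)), P (Q (br a b)), Q (br (P a) b) >].

Lemma nijenhuis_compatible {P : A -> A} :
  nijenhuis_operator br P <-> affine_map P /\ compatible P P.
Proof.
split=> [[Paff Peq]|[Paff PP]]; split=> // a b.
  by rewrite Peq !Paff.1 heap_opC.
by rewrite PP !Paff.1 heap_opC.
Qed.

Lemma compatible_id_l {Q : A -> A} : compatible id Q.
Proof. by move=> a b; rewrite heap_opKr. Qed.

Lemma compatible_id_r {P : A -> A} : compatible P id.
Proof. by move=> a b; rewrite heap_opKl. Qed.

(** Expanding [[Pa,QRb]] by [PQ], then [[Pa,Rb]] by [PR], leaves [QP[a,Rb] - PQ[a,Rb]], which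
    commutation cancels. *)
Lemma compatible_comp_r {P Q R : A -> A} :
  affine_map Q -> (forall a, P (Q a) = Q (P a)) ->
  compatible P Q -> compatible P R -> compatible P (fun a => Q (R a)).
Proof. by move=> Qaff PQC PQ PR a b; rewrite PQ PR !Qaff.1 !PQC; affine. Qed.

(** On this side both expansions produce the same term [QP[Ra,b]], with opposite signs. *)
Lemma compatible_comp_l {P Q R : A -> A} :
  affine_map Q ->
  compatible Q P -> compatible R P -> compatible (fun a => Q (R a)) P.
Proof. by move=> Qaff QP RP a b; rewrite QP RP !Qaff.1; affine. Qed.

Lemma compatible_iter {N : A -> A} k l :
  affine_map N -> compatible N N -> compatible (iter k N) (iter l N).
Proof.
move=> Naff NN.
have iterC m a : iter m N (N a) = N (iter m N a) by rewrite -iterSr.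
have NNl m : compatible N (iter m N).
  elim: m => [|m IHm]; first exact: compatible_id_r.
  exact: compatible_comp_r.
elim: k => [|k IHk]; first exact: compatible_id_l.
exact: compatible_comp_l.
Qed.

Lemma compatible_act_l (x : K) {P Q R : A -> A} :
  affine_map R -> compatible P R -> compatible Q R ->
  compatible (fun a => aff_act x (P a) (Q a)) R.
Proof.
by move=> Raff PR QR a b; rewrite !brl_act PR QR !Raff.2; affine.
Qed.

Lemma compatible_act_r (x : K) {P Q R : A -> A} :
  affine_map R -> compatible R P -> compatible R Q ->
  compatible R (fun a => aff_act x (P a) (Q a)).
Proof.
by move=> Raff RP RQ a b; rewrite !brr_act RP RQ !Raff.2; affine.
Qed.

(** The three brackets in [[Qa,Qb]_P] expand by the pairs [(PQ,Q)], [(Q,Q)], [(Q,PQ)]; on the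
    right-hand side [[Pa,Qb]] and [[Qa,Pb]] expand by [(P,Q)] and [(Q,P)]. *)
Lemma nijenhuis_bracket_compatible {P Q : A -> A} :
  affine_map P -> affine_map Q -> (forall a, P (Q a) = Q (P a)) ->
  compatible P Q -> compatible Q P -> compatible Q Q ->
  nijenhuis_operator (nijenhuis_bracket br P) Q.
Proof.
move=> Paff Qaff PQC PQ QP QQ.
have PQQ : compatible (fun a => P (Q a)) Q by apply: compatible_comp_l.
have QPQ : compatible Q (fun a => P (Q a)) by apply: compatible_comp_r.
split=> // a b; rewrite /nijenhuis_bracket PQQ QPQ QQ PQ QP.
by rewrite !Paff.1 !Qaff.1 !PQC; affine.
Qed.

Lemma nijenhuis_bracket_bi_affine {N : A -> A} :
  affine_map N -> bi_affine (nijenhuis_bracket br N).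
Proof.
move=> Naff; split=> c; apply: affine_map_op.
- exact: brr_aff.
- exact: affine_map_comp.
- exact: affine_map_comp.
- exact: affine_map_comp (brl_aff c) Naff.
- exact: affine_map_comp Naff (brl_aff c).
- exact: brl_aff.
Qed.

End Compatible.

Lemma nijenhuis_bracket_lie {br : A -> A -> A} {N : A -> A} :
  lie_bracket br -> nijenhuis_operator br N ->
  lie_bracket (nijenhuis_bracket br N).
Proof.
move=> [br_aff anti jac] hN.
have [Naff NN] := (nijenhuis_compatible br).1 hN.
have Nop := Naff.1.
have brr_op a : heap_hom (br a) by exact: (br_aff.1 a).1.
have sqE u : nijenhuis_bracket br N u u =
    [< br (N u) (N u), N (br u u), br u u >].
  (* Antisymmetry at [(u,Nu)] gives [[Nu,u] + [u,Nu] = [Nu,Nu] + [u,u]]. *)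
  rewrite /nijenhuis_bracket -(anti u (N u)).
  by apply: emb_inj; rewrite !emb_op; ring.
(* The Nijenhuis identity at [(u,u)], solved for [N^2[u,u]]; it will turn the diagonal terms of the
   Jacobi sum into [[u,u]_N]. *)
have NsqE u : emb (N (N (br u u))) =
    extB (extD (emb (N (br (N u) (N u)))) (emb (N (br u u))))
         (emb (br (N u) (N u))).
  have := nijenhuis_eq hN u u.
  rewrite -/(nijenhuis_bracket br N u u) sqE Nop => /(congr1 emb).
  by rewrite emb_op => ->; ring.
split; first exact: nijenhuis_bracket_bi_affine.
  move=> a b; rewrite !sqE /nijenhuis_bracket; apply: emb_inj.
  (* Three instances of antisymmetry suffice: at [(Na,b)], at [(a,Nb)], and at [(a,b)] under [N]. *)
  have antiE u v : emb (br v u) =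
      extB (extD (emb (br u u)) (emb (br v v))) (emb (br u v)).
    by rewrite -(anti u v) emb_op; ring.
  have NantiE : N (br b b) = [< N (br a b), N (br a a), N (br b a) >].
    by rewrite -Nop anti.
  by rewrite NantiE !emb_op (antiE (N a) b) (antiE a (N b)); ring.
move=> a b c; apply: emb_inj.
have brE u v w :
    nijenhuis_bracket br N u (nijenhuis_bracket br N v w) =
    [< [< br (N u) (br (N v) w), N (br (N u) (br v w)),
          br (N u) (br v (N w)), N (br u (br (N v) w)),
          br u (br (N v) (N w)) >],
       N (br u (br v (N w))), N (N (br u (br v w))) >].
  (* The inner [N[v,w]_N] becomes [[Nv,Nw]]; expanding [[Nu,N[v,w]]] by [NN] then cancels
     [N[u,N[v,w]]]. *)
  rewrite {1}/nijenhuis_bracket -[N (nijenhuis_bracket _ _ _ _)](nijenhuis_eq hN).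
  rewrite /nijenhuis_bracket !brr_op !Nop NN.
  by affine.
(* The Jacobi identity under [f], solved for its third double bracket; the seven uses below, with
   [f] one of [id], [N], [N^2], are the seven Jacobi sums of the decomposition. *)
have jacE f u v w : heap_hom f -> emb (f (br w (br u v))) =
    extB (extB (extD (extD (emb (f (br u u))) (emb (f (br v v))))
                     (emb (f (br w w))))
               (emb (f (br u (br v w)))))
         (emb (f (br v (br w u)))).
  by move=> fop; rewrite -(jac u v w) !fop !emb_op; ring.
have NNop : heap_hom (fun u => N (N u)) by move=> u v w; rewrite !Nop.
rewrite !brE !sqE !emb_op.
rewrite (jacE id (N a) (N b) c) // (jacE id (N a) b (N c)) //.
rewrite (jacE id a (N b) (N c)) // (jacE N (N a) b c) // (jacE N a (N b) c) //.
rewrite (jacE N a b (N c)) // (jacE (fun u => N (N u)) a b c) // !NsqE /=.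
by ring.
Qed.

End SquareZeroExtension.
End Affine.

Theorem theorem4p6 (K : comPzRingType) (A : affineModule K)
    (br : A -> A -> A) (hbr : lie_bracket br)
    (N : A -> A) (hN : nijenhuis_operator br N) :
  forall k l : nat,
    nijenhuis_operator br (iter k N) /\
    (lie_bracket (nijenhuis_bracket br (iter k N)) /\
     nijenhuis_operator (nijenhuis_bracket br (iter k N)) (iter l N)) /\
    (forall alpha : K,
       nijenhuis_operator br
         (fun a : A => aff_act alpha (iter k N a) (iter l N a))).
Proof.
(* Non-emptiness supplies the base point for the [ring] computations. *)
have [o] := aff_inhabited A; have br_aff := lie_bi_affine hbr.
have [Naff NN] := (nijenhuis_compatible br).1 hN.
have Niter m : affine_map (iter m N) by exact: affine_map_iter.
have NNiter m n : compatible br (iter m N) (iter n N).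
  exact: (compatible_iter o).
have hNiter m : nijenhuis_operator br (iter m N) by apply/nijenhuis_compatible.
move=> k l; split=> //; split=> [|x].
  split; first exact: (nijenhuis_bracket_lie o).
  apply: (nijenhuis_bracket_compatible o) => // a.
  by rewrite -!iterD addnC.
have xaff := affine_map_act o x (Niter k) (Niter l).
apply/nijenhuis_compatible; split=> //.
(* Splitting the combination first on the left, with itself as [R], then on the right leaves the
   four pairs formed from [N^k] and [N^l]. *)
by apply: (compatible_act_l o) => //; apply: (compatible_act_r o).
Qed.
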